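(* Let $P$ be a non-empty finite set of primes, let $q$ be the minimum element of $P$, and let $Q\in P$ be an element with maximum value of $\|Q\|_{\log}$ among elements of $P$. Then for all integers $n>1$, \[\|n\|_{P,\log} \leq \|Q\|_{\log} + \frac{q-1}{\log_3 q}.\]
   Context: For a positive integer $m$, $\|m\|$ denotes the minimum number of occurrences of the constant $1$ in an arithmetic expression built only from the constant $1$, addition, multiplication and parentheses whose value is $m$; for $m>1$, $\|m\|_{\log}=\|m\|/\log_3 m$. Given a non-empty finite set $P$ of primes, the $P$-algorithm builds an expression for $n>0$ as follows: (1) if $n=1$, represent $n$ as $1$ and stop; (2) if $n=p\in P$, represent $n$ by a shortest expression of $p$ (with $\|p\|$ ones) and stop; (3) if $n>1$, $n\notin P$ and $n$ is divisible by some $p\in P$, represent $n$ as (shortest expression of $p$)$\cdot\frac{n}{p}$ and continue with $\frac{n}{p}$; (4) if $n>1$ and $n$ is divisible by no $p\in P$, represent $n$ as $1+(n-1)$ and continue with $n-1$. The number of ones in the resulting expression does not depend on the choices made in step (3); it is denoted $\|n\|_P$. Equivalently: $\|1\|_P=1$; $\|p\|_P=\|p\|$ for $p\in P$; $\|n\|_P=\|p\|+\|n/p\|_P$ if $n>1$, $n\notin P$, $p\in P$, $p\mid n$; $\|n\|_P = 1+\|n-1\|_P$ if $n>1$ is divisible by no element of $P$. For $n>1$, $\|n\|_{P,\log}=\|n\|_P/\log_3 n$. *)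

(* Defs.v *)
From HB Require Import structures.
From mathcomp Require Import all_boot all_order all_algebra finmap.
From mathcomp Require Import all_classical all_reals exp.
Set Implicit Arguments.
Unset Strict Implicit.
Unset Printing Implicit Defensive.
Import Order.TTheory GRing.Theory Num.Theory.
Local Open Scope nat_scope.

Inductive expr : Type :=
| One
| Add of expr & expr
| Mul of expr & expr.

Fixpoint value (e : expr) : nat :=
  match e with
  | One => 1
  | Add e1 e2 => value e1 + value e2
  | Mul e1 e2 => value e1 * value e2
  end.

Fixpoint ones (e : expr) : nat :=
  match e with
  | One => 1
  | Add e1 e2 | Mul e1 e2 => ones e1 + ones e2
  end.

Definition shortest (m : nat) (e : expr) : Prop :=
  value e = m /\ forall e', value e' = m -> ones e <= ones e'.

(* ||m||; the default 0 is only reached for m = 0, see [complexity_spec] *)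
Definition complexity (m : nat) : nat :=
  xget 0 [set k | exists2 e, shortest m e & ones e = k]%classic.

(* [P_alg P n e]: some run of the P-algorithm on n outputs e; the choice of
   the divisor p \in P and of the shortest expressions is left free *)
Inductive P_alg (P : {fset nat}) : nat -> expr -> Prop :=
| P_alg_one : P_alg P 1 One
| P_alg_mem (p : nat) e : p \in P -> shortest p e -> P_alg P p e
| P_alg_div n (p : nat) e e' :
    1 < n -> n \notin P -> p \in P -> p %| n ->
    shortest p e -> P_alg P (n %/ p) e' -> P_alg P n (Mul e e')
| P_alg_sub n e :
    1 < n -> (forall p : nat, p \in P -> ~~ (p %| n)) ->
    P_alg P n.-1 e -> P_alg P n (Add One e).

(* ||n||_P; [P_complexity_spec] shows that this is well defined for n > 0
   when P consists of primes *)
Definition P_complexity (P : {fset nat}) (n : nat) : nat :=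
  xget 0 [set k | exists2 e, P_alg P n e & ones e = k]%classic.

Definition log3 (R : realType) (x : R) : R := (ln x / ln 3)%R.

Definition complexity_log (R : realType) (m : nat) : R :=
  ((complexity m)%:R / log3 m%:R)%R.

Definition P_complexity_log (R : realType) (P : {fset nat}) (n : nat) : R :=
  ((P_complexity P n)%:R / log3 n%:R)%R.

Lemma shortest_exists m : 0 < m -> exists e, shortest m e.
Proof.
move=> m_gt0; have [e0 e0m] : exists e, value e = m.
  elim: m m_gt0 => // -[|m] IH _; first by exists One.
  by have [//|e em] := IH; exists (Add One e); rewrite /= em.
have exk : exists k, `[< exists2 e, value e = m & ones e = k >].
  by exists (ones e0); apply/asboolP; exists e0.
case: (ex_minnP exk) => k /asboolP[e em ek] mink; exists e; split=> // e' e'm.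
by rewrite ek; apply: mink; apply/asboolP; exists e'.
Qed.

Lemma shortest_ones m e : shortest m e -> ones e = complexity m.
Proof.
move=> [em emin]; apply/esym/xget_unique; first by exists e.
move=> k [e' [e'm e'min]] <-.
by apply/eqP; rewrite eqn_leq e'min // emin.
Qed.

Lemma complexity_spec m : 0 < m ->
  (exists2 e, value e = m & ones e = complexity m) /\
  (forall e, value e = m -> complexity m <= ones e).
Proof.
move=> /shortest_exists[e em]; rewrite -(shortest_ones em).
by case: em => em emin; split=> //; exists e.
Qed.

Section WellDefined.
Variable P : {fset nat}.
Hypothesis primeP : forall p : nat, p \in P -> prime p.

Lemma P_alg_exists n : 0 < n -> exists e, P_alg P n e.
Proof.
elim/ltn_ind: n => n IH n_gt0.
have [nP|nP] := boolP (n \in P).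
  by have [e ne] := shortest_exists n_gt0; exists e; apply: P_alg_mem.
have [->|n_neq1] := eqVneq n 1; first by exists One; constructor.
have n_gt1 : 1 < n by rewrite ltn_neqAle eq_sym n_neq1.
have [[p [pP pn]]|npP] := pselect (exists p, p \in P /\ p %| n).
  have p_gt1 := prime_gt1 (primeP pP); have p_gt0 := ltnW p_gt1.
  have [e pe] := shortest_exists p_gt0.
  have [||e' ne'] := IH (n %/ p); [exact: ltn_Pdiv|by rewrite divn_gt0 // dvdn_leq|].
  by exists (Mul e e'); apply: (P_alg_div n_gt1 nP pP).
have [||e ne] := IH n.-1; [by rewrite prednK|by case: n n_gt1 {IH n_gt0 nP n_neq1 npP} => [|[]]|].
exists (Add One e); apply: P_alg_sub => // p pP.
by apply/negP => pn; apply: npP; exists p.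
Qed.

Lemma P_alg_value n e : P_alg P n e -> value e = n.
Proof.
elim=> {n e} [|p e _ []|n p e e' _ _ _ pn [ep _] _ IH|n e n1 _ _ IH] //=.
  by rewrite ep IH mulnC divnK.
by rewrite IH add1n prednK // ltnW.
Qed.

Lemma P_alg_ones n e1 e2 : P_alg P n e1 -> P_alg P n e2 -> ones e1 = ones e2.
Proof.
have N1 : 1 \notin P by apply/negP => /primeP.
elim/ltn_ind: n e1 e2 => n IH e1 e2 r1 r2.
case: r1 IH r2 => {n e1} [|n e nP sn|n p e e' n1 nP pP pn se r1|n e n1 nd r1] IH r2.
- inversion r2; subst => //; first by rewrite H in N1.
- inversion r2; subst; first by rewrite nP in N1.
  + by rewrite (shortest_ones sn) (shortest_ones H0).
  + by rewrite nP in H0.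
  + by have := H0 _ nP; rewrite dvdnn.
- have pp := primeP pP; have p_gt0 := prime_gt0 pp.
  inversion r2; subst => //; first by rewrite H in nP.
    rename p0 into p', H1 into p'P, H2 into p'n, H3 into se', H4 into r2'.
    have pp' := primeP p'P; have p'_gt0 := prime_gt0 pp'.
    rewrite /= (shortest_ones se) (shortest_ones se').
    have [epp'|npp'] := eqVneq p p'.
      by subst p'; congr (_ + _); apply: IH r1 r2'; rewrite ltn_Pdiv ?prime_gt1 // ltnW.
    have pcop : coprime p p' by rewrite prime_coprime // dvdn_prime2.
    have /dvdnP[m En] : p * p' %| n by rewrite Gauss_dvd // pn.
    have m_gt0 : 0 < m by case: m En n1 => // ->.
    have En1 : n %/ p = m * p' by rewrite En mulnCA mulKn // mulnC.
    have En2 : n %/ p' = m * p by rewrite En mulnA mulnK.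
    have lt1 : n %/ p < n by rewrite ltn_Pdiv ?prime_gt1 // ltnW.
    have lt2 : n %/ p' < n by rewrite ltn_Pdiv ?prime_gt1 // ltnW.
    have [m1|m_neq1] := eqVneq m 1.
      rewrite m1 mul1n in En1; rewrite m1 mul1n in En2.
      rewrite En1 in r1 lt1; rewrite En2 in r2' lt2.
      rewrite (IH _ lt1 _ _ r1 (P_alg_mem p'P se')).
      rewrite (IH _ lt2 _ _ r2' (P_alg_mem pP se)).
      by rewrite (shortest_ones se) (shortest_ones se') addnC.
    have m_gt1 : 1 < m by rewrite ltn_neqAle eq_sym m_neq1.
    have mulNP r : prime r -> (m * r \notin P) * (1 < m * r).
      move=> pr; split; last by rewrite (leq_trans m_gt1) // leq_pmulr // prime_gt0.
      apply/negP => /primeP; apply/negP/primePn; right; exists r; last exact: dvdn_mull.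
      by rewrite prime_gt1 //= ltn_Pmull // prime_gt0.
    have [e3 r3] := P_alg_exists m_gt0.
    rewrite (IH _ lt1 _ (Mul e0 e3) r1); last first.
      rewrite En1; apply: (P_alg_div (p := p')); rewrite ?mulNP ?dvdn_mull //.
      by rewrite mulnK.
    rewrite (IH _ lt2 _ (Mul e e3) r2'); last first.
      rewrite En2; apply: (P_alg_div (p := p)); rewrite ?mulNP ?dvdn_mull //.
      by rewrite mulnK.
    by rewrite /= (shortest_ones se) (shortest_ones se') addnCA.
  by have := H0 _ pP; rewrite pn.
- inversion r2; subst => //.
  + by have := nd _ H; rewrite dvdnn.
  + by have := nd _ H1; rewrite H2.
  + by rewrite /= (IH _ _ _ _ r1 H1) // prednK // ltnW.
Qed.

Lemma P_complexity_spec n : 0 < n ->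
  (exists e, P_alg P n e) /\
  (forall e, P_alg P n e -> value e = n /\ ones e = P_complexity P n).
Proof.
move=> n_gt0; split; first exact: P_alg_exists.
move=> e ne; split; first exact: P_alg_value ne.
apply/esym/xget_unique; first by exists e.
by move=> k [e' ne' <-]; apply: P_alg_ones ne' ne.
Qed.

Lemma P_complexity1 : P_complexity P 1 = 1.
Proof.
have [_ H] := P_complexity_spec (ltn0Sn 0).
by have [_ <-] := H _ (P_alg_one P).
Qed.

Lemma P_complexity_mem p : p \in P -> P_complexity P p = complexity p.
Proof.
move=> pP; have p_gt0 := prime_gt0 (primeP pP).
have [e pe] := shortest_exists p_gt0; have [_ H] := P_complexity_spec p_gt0.
by have [_ <-] := H _ (P_alg_mem pP pe); apply: shortest_ones.
Qed.

Lemma P_complexity_div n p : 1 < n -> n \notin P -> p \in P -> p %| n ->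
  P_complexity P n = complexity p + P_complexity P (n %/ p).
Proof.
move=> n_gt1 nP pP pn; have p_gt0 := prime_gt0 (primeP pP).
have n_gt0 := ltnW n_gt1.
have np_gt0 : 0 < n %/ p by rewrite divn_gt0 // dvdn_leq.
have [e pe] := shortest_exists p_gt0.
have [[e' ne'] H'] := P_complexity_spec np_gt0.
have [_ H] := P_complexity_spec n_gt0.
have [_ <-] := H _ (P_alg_div n_gt1 nP pP pn pe ne').
by rewrite /= (shortest_ones pe); have [_ ->] := H' _ ne'.
Qed.

Lemma P_complexity_sub n : 1 < n -> (forall p, p \in P -> ~~ (p %| n)) ->
  P_complexity P n = 1 + P_complexity P n.-1.
Proof.
move=> n_gt1 nd; have n_gt0 := ltnW n_gt1.
have n1_gt0 : 0 < n.-1 by case: n n_gt1 {nd n_gt0} => [|[]].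
have [[e ne] H'] := P_complexity_spec n1_gt0.
have [_ H] := P_complexity_spec n_gt0.
have [_ <-] := H _ (P_alg_sub n_gt1 nd ne).
by have [_ /= ->] := H' _ ne.
Qed.

End WellDefined.

(* Main.v *)
(** The algorithm alternates divisions by some [p \in P] with blocks of at most
    [q - 1] subtractions, since a multiple of [q] is met at the latest then.
    A division by [p] costs at most [||Q||_log * log3 p], and as [q <= p] the
    block before it costs at most [(q - 1) / log3 q * log3 p]; these bounds add
    up to the claim.  The run may also end at some [1 < m < q], at cost [m]:
    there [m - 1 <= (q - 1) log m / log q] by concavity of the logarithm, and
    the remaining [1] is paid by [||Q||_log * log3 2 >= 1], because an
    expression with [k] ones has value at most [2 ^ k]. *)
Require Import Defs.
From mathcomp Require Import all_boot all_order all_algebra finmap.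
From mathcomp Require Import all_classical all_reals exp.
From mathcomp Require Import zify ring lra.
Set Implicit Arguments.
Unset Strict Implicit.
Unset Printing Implicit Defensive.
Import Order.TTheory GRing.Theory Num.Theory.

(** Induction on [e]: every expression has at least one [One], so both powers of 2 are at least 2,
    and [x + y <= x * y] for such numbers settles [Add]. *)
Lemma value_le_exp2 (e : expr) : (value e <= 2 ^ ones e)%N.
Proof.
have ones_gt0 : forall e', (0 < ones e')%N.
  by elim=> //= e1 h1 e2 _; rewrite addn_gt0 h1.
elim: e => //= e1 IH1 e2 IH2; rewrite expnD; last exact: leq_mul.
apply: leq_trans (leq_add IH1 IH2) _.
have h (e' : expr) : (2 <= 2 ^ ones e')%N.
  by rewrite -{1}(expn1 2) leq_exp2l.
have := h e1; have := h e2; move: (2 ^ ones e1)%N (2 ^ ones e2)%N => x y.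
by case: x => [|[|x]] //; case: y => [|[|y]] // _ _; nia.
Qed.

Lemma le_exp2_complexity (m : nat) : (0 < m)%N -> (m <= 2 ^ complexity m)%N.
Proof.
by move=> /complexity_spec[[e <- <-] _]; exact: value_le_exp2.
Qed.

Section Logarithm.
Context {R : realType}.
Local Open Scope ring_scope.

Lemma ln_le_subr1 (x : R) : 0 < x -> ln x <= x - 1.
Proof.
by move=> x0; have := @le_ln1Dx R (x - 1); rewrite addrCA subrr addr0 => ->//; lra.
Qed.

(** Concavity: the slope [ln t / (t - 1)] decreases, cross-multiplied so that [x = 1] is allowed.
    Two uses of [ln t <= t - 1], at [x^-1] and at [y / x], suffice. *)
Lemma ln_secant_anti (x y : R) : 1 <= x -> x <= y ->
  (x - 1) * ln y <= (y - 1) * ln x.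
Proof.
move=> x1 xy; have x0 : 0 < x by lra. have y0 : 0 < y by lra.
have hx : 1 - x^-1 <= ln x.
  have := @ln_le_subr1 x^-1; rewrite invr_gt0 lnV ?posrE// => /(_ x0); lra.
have hy : ln y <= ln x + (y / x - 1).
  by rewrite -lerBlDl -ln_div ?posrE// ln_le_subr1// divr_gt0.
have e1 : (y - x) * (1 - x^-1) <= (y - x) * ln x by apply: ler_wpM2l => //; lra.
have e2 : (x - 1) * ln y <= (x - 1) * (ln x + (y / x - 1)).
  by apply: ler_wpM2l => //; lra.
have e3 : (x - 1) * (y / x - 1) = (y - x) * (1 - x^-1).
  by field; rewrite gt_eqF.
by rewrite mulrDr e3 in e2; nra.
Qed.

Lemma ln_nat_gt0 (n : nat) : (1 < n)%N -> 0 < ln n%:R :> R.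
Proof. by move=> n1; rewrite ln_gt0// ltr1n. Qed.

Lemma ler_ln_nat (m n : nat) : (0 < m)%N -> (m <= n)%N ->
  ln m%:R <= ln n%:R :> R.
Proof.
move=> m0 mn; rewrite ler_ln ?ler_nat// posrE ltr0n//.
exact: leq_trans mn.
Qed.

Lemma ln_le_complexity (m : nat) : (0 < m)%N ->
  ln m%:R <= (complexity m)%:R * ln 2 :> R.
Proof.
move=> m0; rewrite mulr_natl -lnXn// -natrX.
by rewrite ler_ln_nat// le_exp2_complexity.
Qed.

End Logarithm.

Section PComplexity.
Variables (P : {fset nat}) (q : nat).
Hypothesis P_prime : forall p : nat, p \in P -> prime p.
Hypothesis q_in : q \in P.
Hypothesis q_min : forall p : nat, p \in P -> (q <= p)%N.

(** Below the least element of [P] the run can only subtract, down to 1. *)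
Lemma P_complexity_small (n : nat) : (0 < n < q)%N -> P_complexity P n = n.
Proof.
elim: n => // -[|n] IH /andP[_ nq]; first exact: P_complexity1.
rewrite (P_complexity_sub P_prime) //= => [|p pP]; first by rewrite IH ?(ltnW nq).
by rewrite gtnNdvd // (leq_trans nq) // q_min.
Qed.

(** Here [s] is the length of the block of subtractions before the next multiple of an element of
    [P]. *)
Lemma P_complexity_descent (n : nat) : (q <= n)%N ->
  exists s p, [/\ (s < q)%N, (q <= n - s)%N, p \in P, p %| n - s &
    P_complexity P n = (s + P_complexity P (n - s))%N].
Proof.
have q0 : (0 < q)%N by apply: prime_gt0; exact: P_prime.
(* Induction on the remainder [r] with [m] fixed. The sharper bound [s <= r] keeps the run at or
   above [m * q], hence at or above [q]. *)
suff H r m : (r < q)%N -> (0 < m)%N -> exists s p,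
    [/\ (s <= r)%N, p \in P, p %| m * q + r - s &
      P_complexity P (m * q + r) = (s + P_complexity P (m * q + r - s))%N].
  move=> qn; rewrite {1 2 3 4}(divn_eq n q).
  have [||s [p [sr pP pn ->]]] := H (n %% q) (n %/ q).
  - by rewrite ltn_mod.
  - by rewrite divn_gt0.
  exists s, p; split => //; first by rewrite (leq_ltn_trans sr)// ltn_mod.
  rewrite -addnBA//; apply: leq_trans (leq_addr _ _).
  by rewrite leq_pmull// divn_gt0.
elim: r => [|r IH] rq m0.
  by exists 0%N, q; rewrite addn0 subn0 dvdn_mull.
have [[p [pP pn]]|npP] := pselect (exists p, p \in P /\ p %| m * q + r.+1).
  by exists 0%N, p; rewrite subn0.
have [s [p [sr pP pn E]]] := IH (ltnW rq) m0.
exists s.+1, p; rewrite addnS subSS; split => //.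
rewrite (P_complexity_sub P_prime) /= ?E //.
  by rewrite ltnS addn_gt0 muln_gt0 m0 q0.
by move=> p' p'P; apply/negP => p'n; apply: npP; exists p'; rewrite addnS.
Qed.

Local Open Scope ring_scope.

(** Strong induction on [n], in natural logarithms; [a] abstracts the largest ratio
    [complexity p / ln p] over [P]. *)
Lemma P_complexity_le_ln (R : realType) (a : R) :
  1 <= a * ln 2 ->
  (forall p : nat, p \in P -> (complexity p)%:R <= a * ln p%:R) ->
  forall n : nat, (1 < n)%N ->
    (P_complexity P n)%:R <= (a + (q%:R - 1) / ln q%:R) * ln n%:R.
Proof.
move=> a2 aP; have q1 : (1 < q)%N by apply: prime_gt1; exact: P_prime.
have lq : 0 < ln q%:R :> R := ln_nat_gt0 q1.
have l2 : 0 < ln 2 :> R := ln_nat_gt0 (isT : 1 < 2)%N.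
have a0 : 0 < a by rewrite -(pmulr_lgt0 _ l2); lra.
set b : R := (q%:R - 1) / ln q%:R.
have b0 : 0 <= b by rewrite divr_ge0 ?(ltW lq) // subr_ge0 ler1n ltnW.
have bq (m : nat) : (q <= m)%N -> q%:R - 1 <= b * ln m%:R.
  move=> qm; apply: (@le_trans _ _ (b * ln q%:R)); first by rewrite divfK ?gt_eqF.
  by rewrite ler_wpM2l// ler_ln_nat// ltnW.
elim/ltn_ind => n IH n1; have n0 : (0 < n)%N := ltnW n1.
rewrite mulrDl; have [nq|qn] := ltnP n q.
  rewrite P_complexity_small ?n0//.
  have h1 : 1 <= a * ln n%:R.
    by apply: le_trans a2 _; rewrite ler_wpM2l ?(ltW a0) // ler_ln_nat.
  have h2 : n%:R - 1 <= b * ln n%:R.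
    rewrite /b mulrAC ler_pdivlMr// ln_secant_anti ?ler1n ?ler_nat//.
    exact: ltnW.
  lra.
have [s [p [sq qns pP pns ->]]] := P_complexity_descent qn.
have p1 := prime_gt1 (P_prime pP); have p0 := ltnW p1.
have sb : s%:R <= q%:R - 1 :> R by rewrite lerBrDr natr1 ler_nat.
have ns0 : (0 < n - s)%N by apply: leq_trans qns; exact: ltnW.
have lns : ln (n - s)%:R <= ln n%:R :> R by rewrite ler_ln_nat// leq_subr.
(* If [n - s] is in [P] the run stops there, and the block is charged to [b * ln n]. *)
rewrite natrD; have [nsP|nsP] := boolP (n - s \in P)%N.
  rewrite P_complexity_mem//; have := aP _ nsP; have := bq _ qn.
  by have := ler_wpM2l (ltW a0) lns; lra.
have ns1 : (1 < n - s)%N by exact: leq_trans qns.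
rewrite (P_complexity_div P_prime ns1 nsP pP pns) natrD.
(* A quotient of 1 would give [n - s = p], which lies in [P]; so the induction hypothesis
   applies. *)
have m1 : (1 < (n - s) %/ p)%N.
  rewrite ltn_divRL// mul1n ltn_neqAle dvdn_leq// andbT.
  by apply: contraNneq nsP => <-.
have mn : ((n - s) %/ p < n)%N.
  by apply: leq_trans (leq_subr s n); rewrite ltn_Pdiv.
have lE : ln (n - s)%:R = ln p%:R + ln ((n - s) %/ p)%:R :> R.
  by rewrite -lnM ?posrE ?ltr0n ?(ltnW m1)// -natrM mulnC divnK.
(* Block and division together cost at most [(a + b) * ln p], which the logarithm of the quotient
   completes to [(a + b) * ln (n - s)]. *)
have := IH _ mn m1; have := aP _ pP; have := bq _ (q_min pP).
have ab0 : 0 <= a + b by lra.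
by have := ler_wpM2l ab0 lns; rewrite lE; lra.
Qed.

End PComplexity.

Theorem theorem3 (R : realType) (P : {fset nat}) (q Q : nat)
  (P_neq0 : P <> fset0)
  (P_prime : forall p : nat, p \in P -> prime p)
  (q_in : q \in P)
  (q_min : forall p : nat, p \in P -> (q <= p)%N)
  (Q_in : Q \in P)
  (Q_max : forall p : nat, p \in P ->
     (complexity_log R p <= complexity_log R Q)%R)
  (n : nat) (n_gt1 : (1 < n)%N) :
  (P_complexity_log R P n
     <= complexity_log R Q + (q%:R - 1) / log3 q%:R)%R.
Proof.
have l3 : (0 < ln 3 :> R)%R := ln_nat_gt0 (isT : 1 < 3)%N.
have lP p : p \in P -> (0 < ln p%:R :> R)%R.
  by move=> /P_prime/prime_gt1; exact: ln_nat_gt0.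
have clE m : complexity_log R m = ((complexity m)%:R / ln m%:R * ln 3)%R.
  by rewrite /complexity_log /log3 invf_div mulrA mulrAC.
(* Passing from base 3 to natural logarithms scales both sides of the claim by [ln 3], which cancels
   at the end. *)
pose a : R := ((complexity Q)%:R / ln Q%:R)%R.
have a2 : (1 <= a * ln 2)%R.
  rewrite /a mulrAC ler_pdivlMr ?lP// mul1r ln_le_complexity//.
  by rewrite prime_gt0// P_prime.
have aP p : p \in P -> ((complexity p)%:R <= a * ln p%:R)%R.
  move=> pP; rewrite -ler_pdivrMr ?lP//.
  by have := Q_max p pP; rewrite !clE ler_pM2r.
have main := @P_complexity_le_ln P q P_prime q_in q_min R a a2 aP n n_gt1.
have ln_n : (0 < ln n%:R :> R)%R := ln_nat_gt0 n_gt1.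
rewrite clE -/a /P_complexity_log /log3 !invf_div !mulrA.
rewrite [leLHS]mulrAC [X in (_ <= _ + X)%R]mulrAC -mulrDl ler_pM2r//.
by rewrite ler_pdivrMr.
Qed.
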